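(* For each positive integer $n$, place $n$ hyper-queens at random on the $3$-dimensional chessboard with side length $n$, and let $\mu_{n,3}$ be the expected proportion of safe spaces. Then in the limit $n\to\infty$ the expected proportion of safe spaces lies between $1/e^6$ and $1/e^{9/2}$, that is, $$\frac{1}{e^{6}}\le \liminf_{n\to\infty}\mu_{n,3}\le\limsup_{n\to\infty}\mu_{n,3}\le \frac{1}{e^{9/2}}.$$
   Context: The $3$-dimensional board of side length $n$ is the set of spaces $\{1,\dots,n\}^3$. ''Placing $n$ pieces at random'' means that the set of occupied spaces (the board configuration) is chosen uniformly among all $\binom{n^3}{n}$ subsets of $n$ distinct spaces. A hyper-queen attacks every space that a hyper-rook or a hyper-bishop at the same position would attack. A hyper-rook at $(a_1,a_2,a_3)$ attacks $(x_1,x_2,x_3)$ if $x_i=a_i$ for some $i$. A hyper-bishop at $(a_1,a_2,a_3)$ attacks $(x_1,x_2,x_3)$ if $(x_1-a_1)\pm(x_2-a_2)\pm(x_3-a_3)=0$ for some choice of the two signs. A space is safe under a board configuration if it is neither occupied nor attacked by any of the placed pieces. The expected proportion of safe spaces $\mu_{n,3}$ is the expected number of safe spaces divided by $n^3$. *)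

(* Defs.v *)
From mathcomp Require Import all_boot all_order all_algebra.
From mathcomp Require Import all_classical all_reals all_analysis.

Set Implicit Arguments.
Unset Strict Implicit.
Unset Printing Implicit Defensive.

Import Order.TTheory GRing.Theory Num.Theory.
Local Open Scope ring_scope.

(* Coordinates run over {0, .., n-1} instead of {1, .., n}: attacks only depend
   on differences of coordinates. *)
Definition space (n : nat) := {ffun 'I_3 -> 'I_n}.

Definition rook_attacks n (a x : space n) : bool :=
  [exists i : 'I_3, x i == a i].

Definition displacement n (a x : space n) (i : 'I_3) : int :=
  (x i)%:Z - (a i)%:Z.

(* The booleans s and t encode the two independent signs. *)
Definition bishop_attacks n (a x : space n) : bool :=
  [exists s : bool, exists t : bool,
    displacement a x 0 + (-1) ^+ s * displacement a x 1
      + (-1) ^+ t * displacement a x 2 == 0].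

Definition queen_attacks n (a x : space n) : bool :=
  rook_attacks a x || bishop_attacks a x.

Definition safe_spaces n (B : {set space n}) : {set space n} :=
  [set x : space n | (x \notin B) && [forall a in B, ~~ queen_attacks a x]]%SET.

Definition configurations n : {set {set space n}} :=
  [set B : {set space n} | #|B| == n]%SET.

Definition uniform_expectation (R : realType) (T : finType) (A : {set T})
    (f : T -> R) : R :=
  (\sum_(x in A) f x) / #|A|%:R.

(* At n = 0 the final division by 0 gives the value 0, which is irrelevant to
   limits as n tends to infinity. *)
Definition mu (R : realType) (n : nat) : R :=
  uniform_expectation (configurations n)
    (fun B : {set space n} => #|safe_spaces B|%:R) / (n ^ 3)%:R.

Lemma card_space n : #|space n| = (n ^ 3)%N.
Proof. by rewrite card_ffun !card_ord. Qed.

Lemma card_configurations n : #|configurations n| = 'C(n ^ 3, n).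
Proof. by rewrite -card_space -card_draws; apply: eq_card => B; rewrite !inE. Qed.

(* Main.v *)
Require Import Defs.
From mathcomp Require Import all_boot all_order all_algebra.
From mathcomp Require Import all_classical all_reals all_analysis.
From mathcomp Require Import zify ring lra.

(* A space attacked from alpha positions is safe with probability
   C(n^3 - alpha, n) / C(n^3, n), which is about exp (- alpha / n^2), so it is
   enough to show 9/2 n^2 - O(n) <= alpha <= 6 n^2 + O(n) for every space.
   The rook part contributes 3 n^2 - O(n).  Cutting the four bishop planes into
   slices along the first coordinate, their number of points is the sum of
   g(e + d) + g(e - d) + g(h + d) + g(h - d) with g(u) = (n - |u|)^+, over a
   window of n consecutive integers d containing 0.  Each of the four sums is
   at most 3/4 n^2 + O(n).  Since |e| + |h| < n, the sum of the four tents is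
   nonincreasing in |d|, so the worst window is 0 <= d < n, on which the total
   is 2 n^2 - (e^2 + h^2) / 2 - O(n) >= 3/2 n^2 - O(n). *)

Import Order.TTheory GRing.Theory Num.Theory.
Import numFieldNormedType.Exports.
Local Open Scope ring_scope.

(* The positive part of n - |u|, by truncated subtraction: the number of points
   of the n x n square on a diagonal at offset u. *)
Definition tent (n : nat) (u : int) : nat := (n - `|u|)%N.

(* An antiderivative of 2 (n - |u|)^+, normalised to vanish at 0. *)
Definition tent2_primitive (n : nat) (u : int) : int :=
  let v := Num.max (- n%:Z) (Num.min n%:Z u) in 2 * n%:Z * v - v * `|v|.

(** * Points on the diagonals and antidiagonals of a square *)

Lemma sum_ord_eqz (n : nat) (v : int) :
  (\sum_(k < n) (k%:Z == v)%R = ((0 <= v) && (v < n%:Z))%R)%N.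
Proof.
elim: n => [|n IHn]; first by rewrite big_ord0; lia.
by rewrite big_ord_recr /= IHn; lia.
Qed.

Lemma sum_ord_interval (m : nat) (l r : int) :
  (\sum_(j < m) ((l <= j%:Z) && (j%:Z < r))%R
    = `|(Num.max 0 (Num.min m%:Z r - Num.max 0 l))%R|)%N.
Proof.
elim: m => [|m IHm]; first by rewrite big_ord0; lia.
by rewrite big_ord_recr /= IHm; lia.
Qed.

(** The longest antidiagonal is [j + k = n - 1], so offsets are measured from there. For fixed [j]
    there is at most one [k], and it exists exactly when [j] lies in an interval. *)
Lemma count_antidiagonal (n : nat) (v : int) :
  (\sum_(j < n) \sum_(k < n) (j%:Z + k%:Z == v)%R
    = tent n (v - n%:Z + 1)%R)%N.
Proof.
rewrite (eq_bigr (fun j : 'I_n =>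
    (((v - n%:Z + 1 <= j%:Z) && (j%:Z < v + 1))%R : nat))); last first.
  move=> j _; transitivity (\sum_(k < n) (k%:Z == v - j%:Z)%R)%N.
    by apply: eq_bigr => k _; lia.
  by rewrite sum_ord_eqz; lia.
by rewrite sum_ord_interval /tent; lia.
Qed.

Lemma count_diagonal (n : nat) (v : int) :
  (\sum_(j < n) \sum_(k < n) (j%:Z - k%:Z == v)%R = tent n v)%N.
Proof.
rewrite (eq_bigr (fun j : 'I_n =>
    (((v <= j%:Z) && (j%:Z < v + n%:Z))%R : nat))); last first.
  move=> j _; transitivity (\sum_(k < n) (k%:Z == j%:Z - v)%R)%N.
    by apply: eq_bigr => k _; lia.
  by rewrite sum_ord_eqz; lia.
by rewrite sum_ord_interval /tent; lia.
Qed.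

(** * Sums of tents over windows of consecutive integers *)

Lemma tent2_primitive_right (n : nat) (u : int) : n%:Z <= u ->
  tent2_primitive n u = n%:Z ^+ 2.
Proof.
move=> nu; rewrite /tent2_primitive min_l // max_r; last lia.
by rewrite ger0_norm; [ring | lia].
Qed.

Lemma tent2_primitive_pos (n : nat) (u : int) : 0 <= u <= n%:Z ->
  tent2_primitive n u = 2 * n%:Z * u - u ^+ 2.
Proof.
move=> /andP[u0 un]; rewrite /tent2_primitive min_r // max_r; last lia.
by rewrite ger0_norm.
Qed.

Lemma tent2_primitiveN (n : nat) (u : int) :
  tent2_primitive n (- u) = - tent2_primitive n u.
Proof.
rewrite /tent2_primitive.
rewrite (_ : Num.max _ (Num.min _ (- u)) = - Num.max (- n%:Z) (Num.min n%:Z u)).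
  by rewrite normrN; ring.
lia.
Qed.

(** On each quadratic piece the discrete derivative differs from twice the tent by 1 at most;
    negative [u] reduces to positive by oddness. Summing these errors gives the error term of
    [sum_tent]. *)
Lemma tent2_step (n : nat) (u : int) :
  `|2 * (tent n u)%:Z - (tent2_primitive n (u + 1) - tent2_primitive n u)| <= 1.
Proof.
have [u0|u0] : 0 <= u \/ u < 0 by lia.
  have [un|nu] : u < n%:Z \/ n%:Z <= u by lia.
    have -> : (tent n u)%:Z = n%:Z - u by rewrite /tent; lia.
    by rewrite !tent2_primitive_pos; lia.
  have -> : (tent n u)%:Z = 0 by rewrite /tent; lia.
  by rewrite !tent2_primitive_right; lia.
have [v v1 ->] : exists2 v : int, 1 <= v & u = - v by exists (- u); lia.
rewrite (_ : - v + 1 = - (v - 1)); last by ring.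
rewrite !tent2_primitiveN.
have [vn|nv] : v <= n%:Z \/ n%:Z < v by lia.
  have -> : (tent n (- v))%:Z = n%:Z - v by rewrite /tent; lia.
  by rewrite !tent2_primitive_pos; lia.
have -> : (tent n (- v))%:Z = 0 by rewrite /tent; lia.
by rewrite !tent2_primitive_right; lia.
Qed.

Lemma sum_tent (n m : nat) (u : int) :
  `|2 * (\sum_(i < m) tent n (u + i%:Z)%R)%N%:Z
     - (tent2_primitive n (u + m%:Z) - tent2_primitive n u)| <= m%:Z.
Proof.
elim: m => [|m IHm]; first by rewrite big_ord0 addr0 subrr.
rewrite big_ord_recr /=; have := tent2_step n (u + m%:Z).
rewrite (_ : u + m.+1%:Z = u + m%:Z + 1); last lia.
by move: IHm; set s := (\sum_(i < m) _)%N; lia.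
Qed.

Lemma tent2_primitive_incr (n : nat) (u : int) :
  2 * (tent2_primitive n (u + n%:Z) - tent2_primitive n u) <= 3 * n%:Z ^+ 2.
Proof.
have incr_ge0 v : 0 <= v ->
    2 * (tent2_primitive n (v + n%:Z) - tent2_primitive n v) <= 3 * n%:Z ^+ 2.
  move=> v0; rewrite tent2_primitive_right; last lia.
  have [vn|nv] : v <= n%:Z \/ n%:Z <= v by lia.
    by rewrite tent2_primitive_pos; nia.
  by rewrite tent2_primitive_right; nia.
have [u0|[u0|u0]] : 0 <= u \/ u <= - n%:Z \/ - n%:Z <= u <= 0 by lia.
- exact: incr_ge0.
- have := incr_ge0 (- (u + n%:Z)) ltac:(lia).
  by rewrite tent2_primitiveN opprD addrNK tent2_primitiveN; lia.
rewrite tent2_primitive_pos; last lia.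
rewrite -[in X in _ - X](opprK u) tent2_primitiveN tent2_primitive_pos; last lia.
(* The gap between the two sides is exactly [(n + 2 * u) ^ 2]: the extremal window is the one
   centred at 0. *)
have := sqr_ge0 (n%:Z + 2 * u); lia.
Qed.

Lemma sum_tent_le (n : nat) (u : int) :
  (4 * \sum_(i < n) tent n (u + i%:Z)%R <= 3 * n ^ 2 + 2 * n)%N.
Proof.
have := sum_tent n n u; have := tent2_primitive_incr n u.
set s := (\sum_(i < n) _)%N; set A := tent2_primitive _ _.
set B := tent2_primitive _ _; lia.
Qed.

(** For [e >= 0] and P the primitive, the two increments add up to
    [n ^ 2 + P (n - e) = 2 * n ^ 2 - e ^ 2], since P is odd and [P (e + n) = n ^ 2]. Each of the two
    sums costs an error [n]. *)
Lemma sum_two_tents_ge (n : nat) (e : int) : `|e| <= n%:Z ->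
  2 * n%:Z ^+ 2 - e ^+ 2 - 2 * n%:Z <=
  2 * (\sum_(d < n) (tent n (e + d%:Z)%R + tent n (e - d%:Z)%R))%N%:Z.
Proof.
move=> he; wlog: e he / 0 <= e => [wl|e0].
  have [e0|e0] : 0 <= e \/ e < 0 by lia.
    exact: wl.
  have := wl (- e); rewrite normrN sqrrN => /(_ he) /(_ ltac:(lia)).
  rewrite (eq_bigr (fun d : 'I_n => tent n (e + d%:Z)%R + tent n (e - d%:Z)%R)%N) //.
  by move=> d _; rewrite /tent; lia.
rewrite big_split /=.
rewrite [X in (_ + X)%N](eq_bigr (fun d : 'I_n => tent n (- e + d%:Z))); last first.
  by move=> d _; rewrite /tent; lia.
have := sum_tent n n e; have := sum_tent n n (- e).
rewrite tent2_primitiveN (tent2_primitive_pos n e); last lia.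
rewrite (tent2_primitive_right n (e + _)); last lia.
rewrite tent2_primitive_pos; last lia.
set s := (\sum_(i < n) _)%N; set t := (\sum_(i < n) _)%N.
nia.
Qed.

(** * Lower bound for four tents over a window containing 0 *)

(** Drop the last index: its distance to [a] is at most its own value, so its term dominates. If [a]
    itself is the last index, the distances are just the indices reversed. *)
Lemma sum_dist_nonincreasing_ge (f : nat -> nat) (n a : nat) : (a < n)%N ->
  (forall i, (i.+1 < n)%N -> (f i.+1 <= f i)%N) ->
  (\sum_(i < n) f i <= \sum_(i < n) f (`|(i%:Z - a%:Z)%R|))%N.
Proof.
elim: n => // n IHn; rewrite ltnS leq_eqVlt => /orP[/eqP-> _|an fdec].
  rewrite (reindex_inj rev_ord_inj) /= leq_eqVlt; apply/orP; left; apply/eqP.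
  by apply: eq_bigr => i _; congr f; have := ltn_ord i; lia.
rewrite !big_ord_recr /= leq_add //; first by apply: IHn => // i ?; apply: fdec; lia.
have -> : (`|(n%:Z - a%:Z)%R| = n - a)%N by lia.
have fle k : (k <= n)%N -> (f n <= f (n - k))%N.
  elim: k => [|k IHk] kn; first by rewrite subn0.
  apply: leq_trans (IHk (ltnW kn)) _.
  by rewrite (_ : n - k = (n - k.+1).+1)%N; [apply: fdec|]; lia.
exact: fle (ltnW an).
Qed.

(* The slice at height d of the four bishop planes through (a, b, c) consists of
   two diagonals at offsets e +- d with e = b - c, and two antidiagonals at
   offsets h +- d with h = b + c - (n - 1). *)
Definition four_tents n (e h : int) (d : int) : nat :=
  (tent n (e + d)%R + tent n (e - d)%R + (tent n (h + d)%R + tent n (h - d)%R))%N.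

(** A pair of tents at offset [p] can grow, by 1, only when [d < p] and [n <= p + d]. Then
    [p + q < n] forces [q < d], so the pair at offset [q] drops by at least 1. *)
Lemma four_tents_nonincreasing (n : nat) (e h : int) (d : nat) :
  (`|e| + `|h| < n)%N -> (d < n)%N ->
  (four_tents n e h d.+1 <= four_tents n e h d)%N.
Proof.
have two_tents u k : (tent n (u + k%:Z)%R + tent n (u - k%:Z)%R
    = (n - (`|u| + k)) + (n - ((`|u| - k) + (k - `|u|))))%N by rewrite /tent; lia.
rewrite /four_tents !two_tents; move: `|e|%N `|h|%N => {e h} p q pq dn {two_tents}.
have [dp|pd] := ltnP d p; have [dq|qd] := ltnP d q;
have [pdn|npd] := ltnP (p + d) n; have [qdn|nqd] := ltnP (q + d) n; lia.
Qed.

Lemma four_tents_abs (n : nat) (e h d : int) :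
  four_tents n e h d = four_tents n e h `|d|%N.
Proof.
have [d0|d0] : (`|d|%N : int) = d \/ (`|d|%N : int) = - d by lia.
  by rewrite d0.
by rewrite d0 /four_tents opprK addnC [RHS]addnC; congr addn; rewrite addnC.
Qed.

Lemma sum_four_tents_ge (n : nat) (e h : int) (a : nat) :
  (a < n)%N -> (`|e| + `|h| < n)%N ->
  (3 * n ^ 2 <= 2 * (\sum_(i < n) four_tents n e h (i%:Z - a%:Z)%R) + 4 * n)%N.
Proof.
move=> an eh.
have -> : (\sum_(i < n) four_tents n e h (i%:Z - a%:Z)%R
   = \sum_(i < n) four_tents n e h `|(i%:Z - a%:Z)%R|%N)%N.
  by apply: eq_bigr => i _; rewrite four_tents_abs.
have := @sum_dist_nonincreasing_ge (fun d => four_tents n e h d) n a an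
  (fun d dn => four_tents_nonincreasing n e h d eh (ltnW dn)).
rewrite /= => le1.
suff sum_ge : (3 * n ^ 2 <= 2 * (\sum_(i < n) four_tents n e h i) + 4 * n)%N.
  by apply: leq_trans sum_ge _; rewrite leq_add2r leq_mul2l.
rewrite big_split /=.
have := @sum_two_tents_ge n e; have := @sum_two_tents_ge n h.
move=> /(_ ltac:(lia)) + /(_ ltac:(lia)).
set s := (\sum_(i < n) _)%N; set t := (\sum_(i < n) _)%N => h1 h2.
have : e ^+ 2 + h ^+ 2 <= n%:Z ^+ 2; last lia.
rewrite -(real_normK (num_real e)) -(real_normK (num_real h)).
apply: (@le_trans _ _ ((`|e| + `|h|) ^+ 2)); last first.
  by rewrite lerXn2r ?nnegrE ?addr_ge0 //; lia.
by rewrite sqrrD -addrA lerD2l ler_wpDl // mulrn_wge0 // mulr_ge0.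
Qed.

(** * The attack relation in terms of displacements *)

Definition attackers {n} (x : Defs.space n) : {set Defs.space n} :=
  [set a | queen_attacks a x]%SET.

Definition triple_space n (u : 'I_n * ('I_n * 'I_n)) : Defs.space n :=
  [ffun t : 'I_3 => nth u.1 [:: u.1; u.2.1; u.2.2] t].

Lemma sum_space n (F : 'I_n -> 'I_n -> 'I_n -> nat) :
  (\sum_(a : Defs.space n) F (a 0%R) (a 1%R) (a 2%:R)
    = \sum_(i < n) \sum_(j < n) \sum_(k < n) F i j k)%N.
Proof.
rewrite (reindex (@triple_space n)) /=; last first.
  exists (fun a => (a 0%R, (a 1%R, a 2%:R))) => [[i [j k]] _|a _].
    by rewrite /triple_space !ffunE.
  apply/ffunP => t; rewrite ffunE.
  by case: t => [[|[|[|t]]] tlt] //=; congr (a _); apply: val_inj.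
rewrite (eq_bigr (fun u : 'I_n * ('I_n * 'I_n) => F u.1 u.2.1 u.2.2)); last first.
  by move=> u _; rewrite /triple_space !ffunE.
rewrite -(pair_big xpredT xpredT (fun i v => F i v.1 v.2)) /=.
by apply: eq_bigr => i _; rewrite -(pair_big xpredT xpredT (fun j k => F i j k)).
Qed.

Lemma exists_bool (P : pred bool) : [exists b, P b] = P false || P true.
Proof.
apply/existsP/orP => [[[] Pb]|[Pb|Pb]]; [by right|by left|by exists false|by exists true].
Qed.

Lemma exists_ord3 (P : pred 'I_3) :
  [exists i, P i] = [|| P 0, P 1 | P 2%:R].
Proof.
apply/existsP/or3P => [[[[|[|[|t]]] tlt] Pb]|[Pb|Pb|Pb]] //.
- by constructor 1; congr (P _) : Pb; apply: val_inj.
- by constructor 2; congr (P _) : Pb; apply: val_inj.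
- by constructor 3; congr (P _) : Pb; apply: val_inj.
- by exists 0.
- by exists 1.
- by exists 2%:R.
Qed.

(** Bishop planes counted with multiplicity. At fixed [d] the first two are antidiagonals in
    [(p, q)], the last two diagonals. *)
Definition plane_count (d p q : int) : nat :=
  ((d + p + q == 0)%R + (d - p - q == 0)%R
   + ((d + p - q == 0)%R + (d - p + q == 0)%R))%N.

Definition queen_displacement (d p q : int) : bool :=
  [|| d == 0, p == 0, q == 0 | (0 < plane_count d p q)%N].

Lemma queen_attacksE n (a x : Defs.space n) :
  queen_attacks a x = queen_displacement
    ((x 0)%:Z - (a 0)%:Z) ((x 1)%:Z - (a 1)%:Z) ((x 2%:R)%:Z - (a 2%:R)%:Z).
Proof.
rewrite /queen_attacks /rook_attacks /bishop_attacks exists_ord3 !exists_bool.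
rewrite /displacement /queen_displacement /plane_count expr0 expr1 !mul1r !mulN1r.
rewrite -!(inj_eq val_inj) /= !subr_eq0 !eqz_nat.
set d := _ - _; set p := _ - _; set q := _ - _.
by do 7 case: (_ == _).
Qed.

Lemma queen_displacement_le (d p q : int) :
  (queen_displacement d p q
    <= (d == 0) + (p == 0) + (q == 0) + plane_count d p q)%N.
Proof.
rewrite /queen_displacement.
by case: (d == 0); case: (p == 0); case: (q == 0); case: plane_count.
Qed.

(* Off the rook region the four planes are pairwise disjoint. *)
Lemma queen_displacement_ge (d p q : int) :
  ((d == 0) + (p == 0) + (q == 0) + plane_count d p q
    <= queen_displacement d p q
       + ((d == 0) * ((p == 0) + plane_count d p q)
          + (p == 0) * ((q == 0) + plane_count d p q)
          + (q == 0) * ((d == 0) + plane_count d p q)))%N.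
Proof.
rewrite /queen_displacement.
have [d0|d0] := eqVneq d 0; have [p0|p0] := eqVneq p 0;
  have [q0|q0] := eqVneq q 0 => /=; try lia.
(* Adding or subtracting two of the plane equations makes one displacement vanish. *)
rewrite /plane_count; lia.
Qed.

Lemma sum_delta n (a : 'I_n) (F : 'I_n -> nat) :
  (\sum_(i < n) (a%:Z - i%:Z == 0)%R * F i = F a)%N.
Proof.
rewrite (bigD1 a) //= subrr eqxx mul1n big1 ?addn0 // => i ia.
by rewrite subr_eq0 eqz_nat eq_sym (inj_eq val_inj) (negbTE ia).
Qed.

Lemma sum_le_one n (Q : pred 'I_n) :
  (forall i j, Q i -> Q j -> i = j) -> (\sum_(i < n) Q i <= 1)%N.
Proof.
move=> Qinj; have [i Qi|Q0] := pickP Q; last by rewrite big1 // => i _; rewrite Q0.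
rewrite (bigD1 i) //= big1 ?addn0 ?leq_b1 // => j ji.
by case Qj: (Q j) => //; rewrite (Qinj _ _ Qi Qj) eqxx in ji.
Qed.

Lemma sum2_le n (Q : 'I_n -> pred 'I_n) :
  (forall i j k, Q i j -> Q i k -> j = k) ->
  (\sum_(i < n) \sum_(j < n) Q i j <= n)%N.
Proof.
move=> Qinj; rewrite -[leqRHS](card_ord n) -sum1_card leq_sum // => i _.
exact/sum_le_one/Qinj.
Qed.

(** * Points on the four bishop planes *)

Section Count.
Variables (n : nat) (a b c : 'I_n).
Let dist (x i : 'I_n) : int := x%:Z - i%:Z.
Let planes i j k := plane_count (dist a i) (dist b j) (dist c k).
Let e : int := b%:Z - c%:Z.
Let h : int := b%:Z + c%:Z - n%:Z + 1.

Lemma slice_count (i : 'I_n) :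
  (\sum_(j < n) \sum_(k < n) planes i j k
    = four_tents n e h (i%:Z - a%:Z)%R)%N.
Proof.
(* Evenness of [four_tents] allows the height [a - i] in place of [i - a]. *)
rewrite four_tents_abs -opprB abszN -four_tents_abs.
rewrite /planes /plane_count /four_tents.
have split4 (A B C D : 'I_n -> 'I_n -> bool) :
   (\sum_(j < n) \sum_(k < n) (A j k + B j k + (C j k + D j k))
    = \sum_(j < n) \sum_(k < n) C j k + \sum_(j < n) \sum_(k < n) D j k
     + (\sum_(j < n) \sum_(k < n) A j k + \sum_(j < n) \sum_(k < n) B j k))%N.
  rewrite [RHS]addnC -!big_split; apply: eq_bigr => j _.
  by rewrite -!big_split.
rewrite split4 /e /h /dist; congr (_ + _ + (_ + _))%N.
- rewrite -count_diagonal; apply: eq_bigr => j _; apply: eq_bigr => k _; lia.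
- rewrite -count_diagonal; apply: eq_bigr => j _; apply: eq_bigr => k _; lia.
- set v := (X in tent n X); rewrite (_ : v = v + n%:Z - 1 - n%:Z + 1); last lia.
  rewrite -count_antidiagonal /v.
  apply: eq_bigr => j _; apply: eq_bigr => k _; lia.
- set v := (X in tent n X); rewrite (_ : v = v + n%:Z - 1 - n%:Z + 1); last lia.
  rewrite -count_antidiagonal /v.
  apply: eq_bigr => j _; apply: eq_bigr => k _; lia.
Qed.

Lemma sum_planes :
  (3 * n ^ 2 <= 2 * (\sum_(i < n) \sum_(j < n) \sum_(k < n) planes i j k) + 4 * n)%N
  /\ (\sum_(i < n) \sum_(j < n) \sum_(k < n) planes i j k <= 3 * n ^ 2 + 2 * n)%N.
Proof.
under eq_bigr do rewrite slice_count; split.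
  have := ltn_ord a; have := ltn_ord b; have := ltn_ord c => cn bn an.
  (* [|e| + |h|] is the larger of [|2 * b - (n - 1)|] and [|2 * c - (n - 1)|], hence at most
     [n - 1]. *)
  by apply: sum_four_tents_ge => //; rewrite /e /h; lia.
rewrite /four_tents !big_split /=.
have plus u : (4 * \sum_(i < n) tent n (u + (i%:Z - a%:Z))%R <= 3 * n ^ 2 + 2 * n)%N.
  under eq_bigr do rewrite addrCA addrC.
  exact: sum_tent_le.
have minus u : (4 * \sum_(i < n) tent n (u - (i%:Z - a%:Z))%R <= 3 * n ^ 2 + 2 * n)%N.
  have := plus (- u); congr (4 * _ <= _)%N; apply: eq_bigr => i _.
  by rewrite /tent -abszN opprD opprK.
move: (plus e) (plus h) (minus e) (minus h).
do 4 (set S := bigop _ _ _; move: S => ?).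
lia.
Qed.
End Count.

(** * Number of attackers of a space *)

Section AttackerCount.
Variables (n : nat) (a b c : 'I_n).
Let dist (x i : 'I_n) : int := x%:Z - i%:Z.
Let planes i j k := plane_count (dist a i) (dist b j) (dist c k).
Let queen i j k := queen_displacement (dist a i) (dist b j) (dist c k).
Let sum3 (F : 'I_n -> 'I_n -> 'I_n -> nat) :=
  (\sum_(i < n) \sum_(j < n) \sum_(k < n) F i j k)%N.

Let sum3D F G : sum3 (fun i j k => F i j k + G i j k)%N = (sum3 F + sum3 G)%N.
Proof.
rewrite /sum3 -big_split; apply: eq_bigr => i _.
by rewrite -big_split; apply: eq_bigr => j _; rewrite -big_split.
Qed.

Let le_sum3 F G : (forall i j k, F i j k <= G i j k)%N -> (sum3 F <= sum3 G)%N.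
Proof. by move=> FG; do 3 (apply: leq_sum => ? _); exact: FG. Qed.

Let sum3_delta1 (F : 'I_n -> 'I_n -> 'I_n -> nat) :
  sum3 (fun i j k => (dist a i == 0)%R * F i j k)%N
    = (\sum_(j < n) \sum_(k < n) F a j k)%N.
Proof.
rewrite -(sum_delta n a (fun i => \sum_(j < n) \sum_(k < n) F i j k))%N.
apply: eq_bigr => i _; rewrite big_distrr; apply: eq_bigr => j _.
by rewrite big_distrr.
Qed.

Let sum3_delta2 (F : 'I_n -> 'I_n -> 'I_n -> nat) :
  sum3 (fun i j k => (dist b j == 0)%R * F i j k)%N
    = (\sum_(i < n) \sum_(k < n) F i b k)%N.
Proof.
apply: eq_bigr => i _; rewrite -(sum_delta n b (fun j => \sum_(k < n) F i j k))%N.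
by apply: eq_bigr => j _; rewrite big_distrr.
Qed.

Let sum3_delta3 (F : 'I_n -> 'I_n -> 'I_n -> nat) :
  sum3 (fun i j k => (dist c k == 0)%R * F i j k)%N
    = (\sum_(i < n) \sum_(j < n) F i j c)%N.
Proof. by do 2 (apply: eq_bigr => ? _); rewrite -sum_delta. Qed.

Let sum2_const (m : nat) : (\sum_(i < n) \sum_(j < n) m = m * n ^ 2)%N.
Proof. by rewrite !big_const_ord !iter_addn_0; lia. Qed.

Let sum3_zero :
  [/\ sum3 (fun i j k => (dist a i == 0)%R : nat) = n ^ 2,
      sum3 (fun i j k => (dist b j == 0)%R : nat) = n ^ 2
    & sum3 (fun i j k => (dist c k == 0)%R : nat) = n ^ 2]%N.
Proof.
have one (F : 'I_n -> 'I_n -> 'I_n -> bool) :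
    sum3 (fun i j k => F i j k : nat) = sum3 (fun i j k => F i j k * 1)%N.
  by do 3 (apply: eq_bigr => ? _); rewrite muln1.
by split; rewrite one (sum3_delta1, sum3_delta2, sum3_delta3) sum2_const mul1n.
Qed.

Lemma sum_queen_le : (sum3 queen <= 6 * n ^ 2 + 2 * n)%N.
Proof.
have [_ planes_le] := sum_planes n a b c; have [za zb zc] := sum3_zero.
have := le_sum3 _ _ (fun i j k =>
  queen_displacement_le (dist a i) (dist b j) (dist c k)).
rewrite 3!sum3D za zb zc => /leq_trans; apply.
apply: leq_trans (leq_add (leqnn _) planes_le) _; lia.
Qed.

(** A rook plane meets each of the five other sets in a partial graph, with at most [n] points; so
    overlaps are only linear in [n]. *)
Let sum2_delta_planes (x : 'I_n) (A B C D : 'I_n -> pred 'I_n) :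
  (forall i j k, A i j -> A i k -> j = k) ->
  (forall i j k, B i j -> B i k -> j = k) ->
  (forall i j k, C i j -> C i k -> j = k) ->
  (forall i j k, D i j -> D i k -> j = k) ->
  (\sum_(i < n) \sum_(j < n) ((dist x j == 0)%R
     + (A i j + B i j + (C i j + D i j))) <= 5 * n)%N.
Proof.
move=> Ai Bi Ci Di.
under eq_bigr do rewrite !big_split /=; rewrite !big_split /=.
have xi (i j k : 'I_n) : dist x j == 0 -> dist x k == 0 -> j = k.
  by rewrite /dist => ? ?; apply: val_inj => /=; lia.
have := @sum2_le n (fun i j => dist x j == 0) xi.
have := @sum2_le n A Ai; have := @sum2_le n B Bi.
have := @sum2_le n C Ci; have := @sum2_le n D Di.
do 5 (set S := bigop _ _ _; move: S => ?).
lia.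
Qed.

(** Rook planes give [3 * n ^ 2], bishop planes half of [3 * n ^ 2 - 4 * n], and the three overlap
    sums remove at most [15 * n]; doubling yields [34 = 4 + 30]. *)
Lemma sum_queen_ge : (9 * n ^ 2 <= 2 * sum3 queen + 34 * n)%N.
Proof.
have [planes_ge _] := sum_planes n a b c; have [za zb zc] := sum3_zero.
have := le_sum3 _ _ (fun i j k => queen_displacement_ge (dist a i) (dist b j) (dist c k)).
have D3 Q A B C : sum3 (fun i j k => Q i j k + (A i j k + B i j k + C i j k))%N
  = (sum3 Q + (sum3 A + sum3 B + sum3 C))%N by rewrite !sum3D.
rewrite 3!sum3D za zb zc D3 sum3_delta1 sum3_delta2 sum3_delta3.
 move: planes_ge; rewrite -/(sum3 planes).
have [] : [/\ \sum_(j < n) \sum_(k < n) ((dist b j == 0)%R + planes a j k) <= 5 * n,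
   \sum_(i < n) \sum_(k < n) ((dist c k == 0)%R + planes i b k) <= 5 * n &
   \sum_(i < n) \sum_(j < n) ((dist a i == 0)%R + planes i j c) <= 5 * n]%N.
  (* The exchanges bring the variable of the rook condition to the inner sum. *)
  split; [rewrite exchange_big | | rewrite exchange_big]; rewrite /planes /plane_count;
    apply: sum2_delta_planes => i j k; rewrite /dist => ? ?;
    apply: val_inj => /=; lia.
do 3 (set S := bigop _ _ _; move: S => ?).
rewrite -/(sum3 queen) /planes /queen.
set s := sum3 (fun i j k => plane_count _ _ _).
set t := sum3 (fun i j k => queen_displacement _ _ _ : nat).
lia.
Qed.
End AttackerCount.

Lemma card_attackers n (x : Defs.space n) :
  (#|attackers x| = \sum_(i < n) \sum_(j < n) \sum_(k < n)
    queen_displacement ((x 0)%:Z - i%:Z)%R ((x 1)%:Z - j%:Z)%R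
      ((x 2%:R)%:Z - k%:Z)%R)%N.
Proof.
rewrite -sum_space -sum1_card big_mkcond /=.
by apply: eq_bigr => a _; rewrite inE queen_attacksE; case: queen_displacement.
Qed.

Lemma card_attackers_bounds n (x : Defs.space n) :
  (9 * n ^ 2 <= 2 * #|attackers x| + 34 * n)%N /\
  (#|attackers x| <= 6 * n ^ 2 + 2 * n)%N.
Proof. by rewrite card_attackers; split; [exact: sum_queen_ge|exact: sum_queen_le]. Qed.

(** * From attacker counts to the expected proportion *)

Section Prob.
Variable R : realType.

(** Double counting: [x] is safe exactly when [B] avoids [attackers x]. As [x] attacks itself, this
    includes [x \notin B]. *)
Lemma sum_safe n :
  (\sum_(B in configurations n) #|safe_spaces B| =
   \sum_(x : Defs.space n) 'C(n ^ 3 - #|attackers x|, n))%N.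
Proof.
under eq_bigr do rewrite -sum1_card.
rewrite (exchange_big_dep xpredT) //=; apply: eq_bigr => x _.
rewrite -card_space -(finset.setCK (attackers x)) -cardsCs -cards_draws -sum1_card.
apply: eq_bigl => B; rewrite !inE andbC; congr (_ && _).
apply/andP/fintype.subsetP => [[xB safe] a aB|sub].
  by rewrite !inE; have /forall_inP := safe; apply.
split; last by apply/forall_inP => a /sub; rewrite !inE.
apply/negP => /sub; rewrite !inE queen_attacksE !subrr /queen_displacement.
by rewrite eqxx.
Qed.

Lemma muE n : mu R n =
  (\sum_(x : Defs.space n) 'C(n ^ 3 - #|attackers x|, n)%:R / 'C(n ^ 3, n)%:R)
   / (n ^ 3)%:R.
Proof.
by rewrite /mu /uniform_expectation card_configurations -natr_sum sum_safe natr_sum mulr_suml.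
Qed.

Lemma mu_bounds n (l u : R) : (0 < n)%N ->
  (forall x : Defs.space n,
     l <= 'C(n ^ 3 - #|attackers x|, n)%:R / 'C(n ^ 3, n)%:R <= u) ->
  l <= mu R n <= u.
Proof.
move=> n0 lu; have n3 : 0 < (n ^ 3)%:R :> R by rewrite ltr0n expn_gt0 n0.
rewrite muE ler_pdivlMr // ler_pdivrMr //.
have cst (r : R) : r * (n ^ 3)%:R = \sum_(x : Defs.space n) r.
  by rewrite sumr_const -[#|_|]/(#|Defs.space n|) card_space mulr_natr.
rewrite !cst; apply/andP; split; apply: ler_sum => x _; by case/andP: (lu x).
Qed.

Lemma bin_ratio (N a n : nat) :
  'C(N - a, n)%:R / 'C(N, n)%:R
    = \prod_(i < n) ((N - a - i)%:R / (N - i)%:R) :> R.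
Proof.
have f0 : n`!%:R != 0 :> R by rewrite pnatr_eq0 -lt0n fact_gt0.
rewrite prodf_div -!natr_prod -!ffact_prod -!bin_ffact !natrM invfM.
by rewrite mulrACA divff ?mulr1.
Qed.

(** Each factor is at most [1 - a / N <= expR (- (a / N))], or is 0 by truncated subtraction. *)
Lemma bin_ratio_le (N a n : nat) : (0 < n)%N -> (n <= N)%N ->
  'C(N - a, n)%:R / 'C(N, n)%:R <= expR (- (n%:R * (a%:R / N%:R))) :> R.
Proof.
move=> n0 nN; rewrite bin_ratio -mulrN expRM_natl.
rewrite -[X in _ ^+ X]card_ord -prodr_const.
apply: ler_prod => i _; have iN : (i < N)%N by apply: leq_trans nN.
have N0 : 0 < N%:R :> R by rewrite ltr0n; lia.
have Ni0 : 0 < (N - i)%:R :> R by rewrite ltr0n; lia.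
rewrite divr_ge0 //=; have [aN|aN] := leqP (a + i) N; last first.
  by rewrite (_ : N - a - i = 0)%N ?mul0r ?expR_ge0 //; lia.
apply: le_trans (expR_ge1Dx _); rewrite ler_pdivrMr //.
rewrite subnAC !natrB; try lia.
have -> : (1 - a%:R / N%:R) * (N%:R - i%:R)
    = N%:R - i%:R - a%:R + a%:R * i%:R / N%:R :> R by field; rewrite gt_eqF.
by rewrite lerDl divr_ge0 // mulr_ge0.
Qed.

(** The inverse of each factor is [1 + a / (N - a - i)], at most [1 + a / (N - n - a)], to which
    [1 + y <= expR y] applies. *)
Lemma bin_ratio_ge (N a n : nat) : (n + a < N)%N ->
  expR (- (n%:R * (a%:R / (N - n - a)%:R))) <= 'C(N - a, n)%:R / 'C(N, n)%:R :> R.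
Proof.
move=> naN; rewrite bin_ratio -mulrN expRM_natl.
rewrite -[X in _ ^+ X]card_ord -prodr_const.
apply: ler_prod => i _; have := ltn_ord i => i_n.
have D0 : 0 < (N - n - a)%:R :> R by rewrite ltr0n; lia.
have F0 : 0 < (N - a - i)%:R :> R by rewrite ltr0n; lia.
have Ni0 : 0 < (N - i)%:R :> R by rewrite ltr0n; lia.
rewrite expR_ge0 expRN -[leRHS]invf_div lef_pV2 ?posrE ?expR_gt0 ?divr_gt0 //=.
apply: le_trans (expR_ge1Dx _).
have -> : (N - i)%:R = (N - a - i)%:R + a%:R :> R by rewrite -natrD; congr _%:R; lia.
rewrite mulrDl divff ?gt_eqF // lerD2l ler_wpM2l // lef_pV2 ?posrE // ler_nat; lia.
Qed.

(** The exponent is at most [- 9 / 2 + 17 / n], and [1 / n <= 2 / (n + 1)] turns 17 into 34. *)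
Lemma mu_le n : (0 < n)%N -> mu R n <= expR (- (9 / 2) + 34 * harmonic n).
Proof.
move=> n0; suff : 0 <= mu R n <= expR (- (9 / 2) + 34 * harmonic n).
  by case/andP.
apply: mu_bounds => // x; rewrite divr_ge0 //=.
have [ge _] := card_attackers_bounds n x.
have nn3 : (n <= n ^ 3)%N by rewrite -{1}(expn1 n) leq_pexp2l.
apply: le_trans (bin_ratio_le _ _ _ n0 nn3) _; rewrite ler_expR.
move: #|attackers x| ge => m ge.
have {}ge : 9 * n%:R ^+ 2 <= 2 * m%:R + 34 * n%:R :> R.
  by rewrite -natrX -!natrM -natrD ler_nat.
rewrite natrX /harmonic /=.
have n1 : 1 <= n%:R :> R by rewrite ler1n.
rewrite -[n.+1%:R]natr1; move: (n%:R) n1 (m%:R) ge => t t1 s ge.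
have t0 : t != 0 by lra.
have t10 : t + 1 != 0 by lra.
rewrite -subr_ge0 (_ : _ - _ =
  (2 * s + 34 * t - 9 * t ^+ 2 + 34 * t * (t - 1) / (t + 1)) / (2 * t ^+ 2)).
  apply: divr_ge0; last by nra.
  apply: addr_ge0; first by lra.
  by apply: divr_ge0; nra.
by field; rewrite t0 t10.
Qed.

(** To first order the exponent is at worst [- (6 + 38 / n)]. The 38 is doubled once to absorb
    lower-order terms and once to replace [1 / n] by [1 / (n + 1)]. *)
Lemma mu_ge n : (20 <= n)%N -> expR (- 6 - 152 * harmonic n) <= mu R n.
Proof.
move=> n20; have n0 : (0 < n)%N by lia.
suff : expR (- 6 - 152 * harmonic n) <= mu R n <= 1 by case/andP.
apply: mu_bounds => // x.
have [_ le] := card_attackers_bounds n x.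
have lt : (n + #|attackers x| < n ^ 3)%N by nia.
apply/andP; split; last first.
  rewrite ler_pdivrMr ?mul1r ?ler_nat ?ltr0n ?bin_gt0; last lia.
  by apply: leq_bin2l; lia.
apply: le_trans (bin_ratio_ge _ _ _ lt); rewrite ler_expR -opprD lerN2 mulrA.
have {}lt : (0 < n ^ 3 - n - #|attackers x|)%N by lia.
rewrite ler_pdivrMr ?ltr0n // !natrB; try lia.
move: #|attackers x| le => m le.
have {}le : m%:R <= 6 * n%:R ^+ 2 + 2 * n%:R :> R.
  by rewrite -natrX -!natrM -natrD ler_nat.
rewrite natrX /harmonic /=.
have n1 : 20 <= n%:R :> R by rewrite ler_nat.
rewrite -[n.+1%:R]natr1; move: (n%:R) n1 (m%:R) le => t t1 s le.
have h_ge : (2 * t)^-1 <= (t + 1)^-1 by rewrite lef_pV2 ?posrE; lra.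
have D0 : 0 <= t ^+ 3 - t - (6 * t ^+ 2 + 2 * t) by nra.
apply: (@le_trans _ _ ((6 + 152 * (2 * t)^-1)
   * (t ^+ 3 - t - (6 * t ^+ 2 + 2 * t)))); last first.
  apply: ler_pM => //; last lra.
    by rewrite addr_ge0 // mulr_ge0 // invr_ge0; lra.
  by rewrite lerD2l ler_wpM2l.
apply: (@le_trans _ _ (t * (6 * t ^+ 2 + 2 * t))).
  by rewrite ler_wpM2l //; lra.
rewrite -subr_ge0 (_ : _ - _ = 38 * t ^+ 2 - 474 * t - 228); first nra.
by field; lra.
Qed.

Lemma cvg_expR_harmonic (c d : R) :
  (expR (c + d * harmonic n) @[n --> \oo] --> expR c)%classic.
Proof.
apply: continuous_cvg; first exact: continuous_expR.
rewrite -[X in (_ --> X)%classic]addr0; apply: cvgD; first exact: cvg_cst.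
rewrite -(mulr0 d); apply: cvgM; [exact: cvg_cst|exact: cvg_harmonic].
Qed.
End Prob.

(** * Passage to lower and upper limits *)

Section Limsup.
Variable R : realType.
Local Open Scope ereal_scope.
Local Open Scope classical_set_scope.
Implicit Types u v : (\bar R)^nat.

Lemma near_le_limn_esup u v :
  (\forall n \near \oo, u n <= v n) -> limn_esup u <= limn_esup v.
Proof.
move=> [N _ uv]; rewrite !limn_esup_lim.
apply: lee_lim; [exact: is_cvg_esups|exact: is_cvg_esups|].
exists N => // n /= Nn; apply: ge_ereal_sup => _ [m /= nm <-].
apply: le_trans (uv m (leq_trans Nn nm)) _.
by apply: ereal_sup_ubound; exists m.
Qed.

Lemma near_le_limn_einf u v :
  (\forall n \near \oo, u n <= v n) -> limn_einf u <= limn_einf v.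
Proof.
move=> uv; rewrite leeN2; apply: near_le_limn_esup.
by apply: filterS uv => n; rewrite leeN2.
Qed.
End Limsup.

Local Open Scope ereal_scope.

Theorem mainTheorem9 (R : realType) :
  [/\ (1 / expR 6)%:E <= limn_einf (fun n : nat => (mu R n)%:E),
      limn_einf (fun n : nat => (mu R n)%:E)
        <= limn_esup (fun n : nat => (mu R n)%:E)
    & limn_esup (fun n : nat => (mu R n)%:E) <= (1 / expR (9 / 2))%:E].
Proof.
have lim (c d : R) : ((expR (c + d * harmonic n)%R)%:E @[n --> \oo] --> (expR c)%:E)%classic.
  by apply: cvg_EFin; [exact: nearW|exact: cvg_expR_harmonic].
split; first 2 last.
(* The bounding sequence converges, so the target constant is its upper limit; likewise for the
   lower limit below. *)
- rewrite div1r -expRN -(cvg_limn_einf_sup (lim (- (9 / 2))%R 34%R)).2.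
  by apply: near_le_limn_esup; exists 1%N => // n /= n0; rewrite lee_fin mu_le.
- rewrite div1r -expRN -(cvg_limn_einf_sup (lim (- 6)%R (- 152)%R)).1.
  by apply: near_le_limn_einf; exists 20%N => // n /= n20; rewrite lee_fin mulNr mu_ge.
- exact: limn_einf_sup.
Qed.
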